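(* Let $X$ be an infinite dimensional Banach space with the $\pi_\lambda$-property, and let $Z$ be a Banach space with a basis $(z_i)$ satisfying, for some choice of $1<q<p<\infty$, lower $\ell_p$ and upper $\ell_q$ estimates, i.e. there is a constant $C$ such that for all finitely supported real sequences $(a_i)$ $$\frac1C\Big(\sum|a_i|^p\Big)^{1/p}\le\Big\|\sum a_iz_i\Big\|\le C\Big(\sum|a_i|^q\Big)^{1/q}.$$ Then no frame of $X$ has the NQP with respect to $(Z,(z_i))$.
   Context: All Banach spaces are real; ''basis'' means Schauder basis. $X$ has the $\pi_\lambda$-property if there is a sequence $(P_n)$ of finite rank projections on $X$ with $\sup_n\|P_n\|<\infty$ and $x=\lim_nP_n(x)$ in norm for all $x\in X$. A sequence $(x_i,f_i)_{i\in\mathbb{N}}$, $x_i\in X$, $f_i\in X^*$, is a (Schauder) frame of $X$ if $x=\sum_{i=1}^\infty f_i(x)x_i$ in norm for every $x\in X$. A Banach space $Z$ with basis $(z_i)$ is associated to the frame if $S:Z\to X$, $\sum a_iz_i\mapsto\sum a_ix_i$, and $T:X\to Z$, $x\mapsto\sum_{x_i\ne0}f_i(x)z_i$, are well-defined bounded operators. The frame has the NQP with respect to $(Z,(z_i))$ if $(Z,(z_i))$ is associated to it and there are $\varepsilon,\delta>0$ and $C'\ge1$ such that for all $x\in X$ there is a finitely supported $(k_i)\subset\mathbb{Z}$ with $\|\sum k_i\delta z_i\|_Z\le C'\|x\|$ and $\|x-\sum\delta k_ix_i\|_X\le\varepsilon$. *)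

(* Defs.v *)
From HB Require Import structures.
From mathcomp Require Import all_boot all_order all_algebra finmap.
From mathcomp Require Import boolp classical_sets functions reals constructive_ereal ereal.
From mathcomp Require Import topology normedtype sequences exp.

Set Implicit Arguments.
Unset Strict Implicit.
Unset Printing Implicit Defensive.

Import Order.TTheory GRing.Theory Num.Theory.
Import numFieldTopology.Exports numFieldNormedType.Exports.

Local Open Scope classical_set_scope.
Local Open Scope ring_scope.

Definition lin_span (R : realType) (X : normedModType R) (s : seq X) : set X :=
  [set v | exists a : 'I_(size s) -> R, v = \sum_(i < size s) a i *: s`_i].

Definition finite_dimensional (R : realType) (X : normedModType R)
  (V : set X) : Prop :=
  exists s : seq X, V `<=` lin_span s.

(* Valued in \bar R, because [sup] on [R] takes a junk value on unbounded
   sets. *)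
Definition opnorm (R : realType) (X Y : normedModType R) (f : X -> Y) : \bar R :=
  ereal_sup [set `|f v|%:E | v in [set v : X | `|v| <= 1]].

Definition finite_rank_projection (R : realType) (X : normedModType R)
  (P : {linear X -> X}) : Prop :=
  [/\ continuous P, (forall v, P (P v) = P v) & finite_dimensional (range P)].

Definition pi_property (R : realType) (X : normedModType R) : Prop :=
  exists P : nat -> {linear X -> X},
    [/\ (forall n, finite_rank_projection (P n)),
        (ereal_sup (range (fun n => opnorm (P n))) < +oo)%E
      & forall v : X, P n v @[n --> \oo] --> v].

Definition schauder_basis (R : realType) (Z : normedModType R)
  (z : nat -> Z) : Prop :=
  forall v : Z, exists! a : nat -> R, series (fun i => a i *: z i) @ \oo --> v.

Definition schauder_frame (R : realType) (X : normedModType R)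
  (x : nat -> X) (f : nat -> {linear X -> R^o}) : Prop :=
  (forall i, continuous (f i)) /\
  (forall v : X, series (fun i => (f i v : R) *: x i) @ \oo --> v).

(* [S] is the operator [\sum a_i z_i |-> \sum a_i x_i] and [T] the operator
   [v |-> \sum_{x_i != 0} f_i(v) z_i]; the convergence of the series in the
   target space is part of each being well defined. *)
Definition associated (R : realType) (X Z : normedModType R)
  (x : nat -> X) (f : nat -> {linear X -> R^o}) (z : nat -> Z) : Prop :=
  (exists S : {linear Z -> X}, continuous S /\
     forall (a : nat -> R) (w : Z),
       series (fun i => a i *: z i) @ \oo --> w ->
       series (fun i => a i *: x i) @ \oo --> S w) /\
  (exists T : {linear X -> Z}, continuous T /\
     forall v : X,
       \sum_(0 <= i < n | x i != 0) (f i v : R) *: z i @[n --> \oo] --> T v).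

Definition NQP (R : realType) (X Z : normedModType R)
  (x : nat -> X) (f : nat -> {linear X -> R^o}) (z : nat -> Z) : Prop :=
  associated x f z /\
  exists eps delta C' : R, [/\ 0 < eps, 0 < delta, 1 <= C' &
    forall v : X, exists k : {fsfun nat -> int with 0},
      `|\sum_(i <- finsupp k) (delta * (k i)%:~R) *: z i| <= C' * `|v| /\
      `|v - \sum_(i <- finsupp k) (delta * (k i)%:~R) *: x i| <= eps].

Definition lower_estimate (R : realType) (Z : normedModType R)
  (z : nat -> Z) (p C : R) : Prop :=
  forall a : {fsfun nat -> R with 0},
    C^-1 * (\sum_(i <- finsupp a) `|a i| `^ p) `^ p^-1
      <= `|\sum_(i <- finsupp a) a i *: z i|.

Definition upper_estimate (R : realType) (Z : normedModType R)
  (z : nat -> Z) (q C : R) : Prop :=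
  forall a : {fsfun nat -> R with 0},
    `|\sum_(i <- finsupp a) a i *: z i|
      <= C * (\sum_(i <- finsupp a) `|a i| `^ q) `^ q^-1.

(* Main.v *)
Require Import Defs.
From HB Require Import structures.
From mathcomp Require Import all_boot all_order all_algebra finmap perm.
From mathcomp Require Import boolp classical_sets functions reals constructive_ereal ereal.
From mathcomp Require Import topology normedtype sequences exp derive.
From mathcomp Require Import zify ring lra.

(* Let [P] be one of the projections, of large rank [d], and let
   [rho = 2 (La + 1) eps], where [La] bounds the norms of the projections. By the
   lower estimate, a vector of norm at most [rho] is within [eps] of some
   [\sum_i delta k_i x_i] with [\sum_i |k_i| <= N], where [N] does not depend
   on [d]. By the upper estimate with [q > 1], and in coordinates of the range of
   [P] with respect to an almost Auerbach basis, only polynomially many (in [d])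
   of the vectors [P x_i] have a norm above a fixed threshold; the other ones are
   negligible in a sum of [N] terms. So the ball of radius [rho] of the
   [d]-dimensional range of [P] is covered by polynomially many balls of radius
   [rho / 2], whereas at least [2^d] such balls are needed. *)

Import Order.TTheory GRing.Theory Num.Theory.
Import numFieldTopology.Exports numFieldNormedType.Exports.

Local Open Scope classical_set_scope.
Local Open Scope ring_scope.

(** * Norms of linear combinations *)

(** Coefficients are row vectors, so that matrices act on them and their space has a norm with
    compact unit sphere. *)
Definition comb {R : realType} {X : normedModType R} {d : nat}
    (v : 'I_d -> X) (a : 'rV[R]_d) : X :=
  \sum_j a ord0 j *: v j.

Definition lin_indep {R : realType} {X : normedModType R} {d : nat}
    (v : 'I_d -> X) : Prop :=
  forall a : 'rV[R]_d, comb v a = 0 -> a = 0.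

Section Comb.
Context {R : realType} {X : normedModType R}.

Lemma combD {d} (v : 'I_d -> X) a b : comb v (a + b) = comb v a + comb v b.
Proof.
by rewrite /comb -big_split; apply: eq_bigr => j _; rewrite mxE scalerDl.
Qed.

Lemma combZ {d} (v : 'I_d -> X) l a : comb v (l *: a) = l *: comb v a.
Proof.
by rewrite /comb scaler_sumr; apply: eq_bigr => j _; rewrite mxE scalerA.
Qed.

Lemma combB {d} (v : 'I_d -> X) a b : comb v (a - b) = comb v a - comb v b.
Proof. by rewrite combD -scaleN1r combZ scaleN1r. Qed.

Lemma comb_delta {d} (v : 'I_d -> X) j : comb v (delta_mx 0 j) = v j.
Proof.
rewrite /comb (bigD1 j) //= big1 => [|i ij]; rewrite mxE ?eqxx ?scale1r ?addr0 //.
by rewrite (negbTE ij) scale0r.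
Qed.

Lemma comb_inj {d} {v : 'I_d -> X} :
  lin_indep v -> injective (comb v).
Proof.
by move=> fv a b e; apply/eqP; rewrite -subr_eq0; apply/eqP/fv; rewrite combB e subrr.
Qed.

Lemma comb_continuous {d} (v : 'I_d -> X) : continuous (comb v).
Proof.
apply: continuous_big => [|j _ a]; first exact: add_continuous.
apply: cvgZr_tmp; [exact: (nbhs_filter a)|exact: coord_continuous].
Qed.

Lemma coord_le_norm {d} (a : 'rV[R]_d) j : `|a ord0 j| <= `|a|.
Proof.
rewrite [leRHS]/Num.norm /= mx_normrE; apply/bigmax_geP; right => /=.
by exists (ord0, j).
Qed.

(* The unit sphere of R^d is compact, so [|comb v a|] attains there a minimum,
   which is positive by independence. *)
Lemma comb_lower {d} {v : 'I_d -> X} : lin_indep v ->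
  exists2 c : R, 0 < c & forall (a : 'rV[R]_d) j, c * `|a ord0 j| <= `|comb v a|.
Proof.
(* For [d = 0] the unit sphere is empty. *)
case: d v => [|d] v fv; first by exists 1 => // a [].
pose A := [set a : 'rV[R]_d.+1 | `|a| = 1].
have nrm_cont : continuous (fun a : 'rV[R]_d.+1 => `|a|) by exact: norm_continuous.
have A0 : A !=set0.
  exists (`|const_mx 1 : 'rV[R]_d.+1|^-1 *: const_mx 1).
  rewrite /A/= normrZ normfV normr_id mulVf //.
  apply/eqP => /normr0_eq0/rowP/(_ ord0); rewrite !mxE => /eqP.
  by rewrite oner_eq0.
have cA : compact A.
  apply: bounded_closed_compact.
    by exists 1; split => // M M1 a /= ->; exact: ltW.
  have -> : A = (fun a : 'rV[R]_d.+1 => `|a|) @^-1` [set 1] by [].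
  apply: preimage_closed => [a _|]; [exact: nrm_cont|exact: closed_eq].
have [a0 a0A amin] : exists2 c, c \in A & forall t, t \in A -> `|comb v c| <= `|comb v t|.
  apply: (@EVT_min_rV R _ (fun a => `|comb v a|) A A0 cA).
  apply: continuous_subspaceT => a.
  by apply: continuous_comp; [exact: comb_continuous|exact: norm_continuous].
have a0n0 : `|comb v a0| != 0.
  apply/eqP => /normr0_eq0/fv a00; move: a0A; rewrite inE /A/= a00 normr0 => /eqP.
  by rewrite eq_sym oner_eq0.
exists `|comb v a0|; first by rewrite lt_def a0n0 normr_ge0.
move=> a j; have [->|an0] := eqVneq a 0; first by rewrite mxE normr0 mulr0.
apply: (@le_trans _ _ (`|comb v a0| * `|a|)).
  by rewrite ler_wpM2l // coord_le_norm.
have nan0 : 0 < `|a| by rewrite normr_gt0.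
rewrite -ler_pdivlMr //.
have -> : `|comb v a| / `|a| = `|comb v (`|a|^-1 *: a)|.
  by rewrite combZ normrZ normfV normr_id mulrC.
by apply: amin; rewrite inE /A/= normrZ normfV normr_id mulVf // gt_eqF.
Qed.

End Comb.

(** * Dimension of the ranges *)

Section Dimension.
Context {R : realType} {X : normedModType R}.

Definition extend {d : nat} (v : 'I_d -> X) (u : X) (i : 'I_d.+1) : X :=
  if unlift ord0 i is Some j then v j else u.

Lemma comb_extend {d} (v : 'I_d -> X) u (a : 'rV[R]_d.+1) :
  comb (extend v u) a
  = a ord0 ord0 *: u + comb v (\row_j a ord0 (lift ord0 j)).
Proof.
rewrite /comb big_ord_recl /extend unlift_none; congr (_ + _).
by apply: eq_bigr => j _; rewrite liftK mxE.
Qed.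

(** A relation with nonzero coefficient at [u] would express [u] through [v]. *)
Lemma lin_indep_extend {d} {v : 'I_d -> X} {u : X} :
  lin_indep v -> ~ (exists a, u = comb v a) -> lin_indep (extend v u).
Proof.
move=> fv nu a; rewrite comb_extend => e.
have [a0|a0] := eqVneq (a ord0 ord0) 0.
  move: e; rewrite a0 scale0r add0r => /fv /rowP e.
  apply/rowP => i; rewrite mxE; case: (unliftP ord0 i) => [j|] -> //.
  by have := e j; rewrite !mxE.
case: nu; exists (- (a ord0 ord0)^-1 *: \row_j a ord0 (lift ord0 j)).
rewrite combZ scaleNr -scalerN.
have -> : - comb v (\row_j a ord0 (lift ord0 j)) = a ord0 ord0 *: u.
  by apply/esym/eqP; rewrite -addr_eq0 e.
by rewrite scalerA mulVf // scale1r.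
Qed.

Lemma comb_in_lin_span {d} (v : 'I_d -> X) a :
  lin_span [tuple v j | j < d] (comb v a).
Proof.
pose sz := size_tuple [tuple v j | j < d].
exists (fun i => a ord0 (cast_ord sz i)).
rewrite /comb (reindex (cast_ord sz)) /=; last first.
  by exists (cast_ord (esym sz)) => i _; rewrite ?cast_ordK ?cast_ordKV.
apply: eq_bigr => i _; congr (_ *: _).
by rewrite -[LHS](tnth_mktuple v (cast_ord sz i)) (tnth_nth 0).
Qed.

Lemma exists_lin_indep : ~ finite_dimensional [set: X] ->
  forall m, exists v : 'I_m -> X, lin_indep v.
Proof.
move=> inf; elim=> [|m [v fv]].
  by exists (fun=> 0) => a _; apply/rowP => -[].
have [u nu] : exists u, ~ exists a, u = comb v a.
  apply: contra_notP inf => /forallNP h; exists [tuple v j | j < m] => u _.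
  by have [a ->] := contrapT (h u); exact: comb_in_lin_span.
by exists (extend v u); exact: lin_indep_extend.
Qed.

(** The matrix [M] of coefficients of [v] in [s] has independent rows, hence at most as many rows as
    columns. *)
Lemma lin_indep_le_size {d} {v : 'I_d -> X} (s : seq X) :
  lin_indep v -> (forall j, lin_span s (v j)) -> (d <= size s)%N.
Proof.
move=> fv /choice[A vA].
pose M : 'M[R]_(d, size s) := \matrix_(i, j) A i j.
suff /eqP <- : row_free M by exact: rank_leq_col.
apply: inj_row_free => a aM0; apply: fv.
transitivity (\sum_(i < size s) (a *m M) ord0 i *: s`_i); last first.
  by rewrite big1 // => i _; rewrite aM0 mxE scale0r.
under [RHS]eq_bigr do rewrite mxE scaler_suml.
rewrite exchange_big; apply: eq_bigr => j _.
by rewrite vA scaler_sumr; apply: eq_bigr => i _; rewrite mxE scalerA.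
Qed.

(** Independent families in the range have bounded length; one of maximal length is a basis, and
    [P \o v] competes for the maximum. *)
Lemma range_basis {P : {linear X -> X}} {m} {v : 'I_m -> X} :
  finite_dimensional (range P) -> lin_indep (P \o v) ->
  exists d, (m <= d)%N /\ exists w : 'I_d -> X,
    [/\ lin_indep w, forall j, range P (w j)
      & forall u, exists a, P u = comb w a].
Proof.
move=> [s Ps] fPv.
pose Q d := `[< exists2 w : 'I_d -> X, lin_indep w & forall j, range P (w j) >].
have exQ : exists d, Q d.
  by exists m; apply/asboolP; exists (P \o v) => // j; exists (v j).
have Qle d : Q d -> (d <= size s)%N.
  by move=> /asboolP[w fw Pw]; apply: (lin_indep_le_size _ fw) => j; exact/Ps/Pw.
case: (ex_maxnP exQ Qle) => d /asboolP[w fw Pw] dmax.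
exists d; split.
  by apply: dmax; apply/asboolP; exists (P \o v) => // j; exists (v j).
exists w; split => // u; apply: contrapT => nu.
suff /dmax : Q d.+1 by rewrite ltnn.
apply/asboolP; exists (extend w (P u)); first exact: lin_indep_extend.
by move=> j; rewrite /extend; case: unliftP => [i _|_]; [exact: Pw|exists u].
Qed.

(** Independence survives small perturbations: if [a] is a relation between the [P n (v j)], then
    [comb v a] is a combination of the small vectors [v j - P n (v j)], too small for
    [comb_lower]. *)
Lemma lin_indep_approx {P : nat -> {linear X -> X}} {m} {v : 'I_m -> X} :
  (forall u, P n u @[n --> \oo] --> u) -> lin_indep v ->
  exists n, lin_indep (P n \o v).
Proof.
move=> Pu fv; have [c c0 vc] := comb_lower fv.
(* Dividing by [m.+1] keeps the total error of the [m] terms strictly below [c] times the norm of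
   [a]. *)
have cm : 0 < c / m.+1%:R by rewrite divr_gt0.
have : \forall n \near \oo, forall j : 'I_m, `|v j - P n (v j)| < c / m.+1%:R.
  apply: filter_forall => j.
  by have /cvgrPdist_lt/(_ _ cm) := Pu (v j).
move=> [n _ /(_ n (leqnn n)) vP]; exists n => a e.
apply: contrapT => /eqP a0.
have [[i0 i] ai] : exists i, `|a| = `|a i.1 i.2|.
  by apply: mx_norm_neq0; apply: contra_neq a0; exact: mx_norm_eq0.
have na0 : 0 < `|a| by rewrite normr_gt0.
have := vc a i; rewrite -[i0]/((i0, i).1) in ai *.
rewrite (ord1 i0) /= in ai; rewrite -ai => le1.
have : `|comb v a| <= \sum_(j < m) `|a| * (c / m.+1%:R).
  rewrite -[comb v a]subr0 -e /comb -sumrB.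
  apply: le_trans (ler_norm_sum _ _ _) _; apply: ler_sum => j _.
  rewrite -scalerBr normrZ; apply: ler_pM => //; first exact: coord_le_norm.
  exact: ltW.
rewrite sumr_const card_ord -[_ *+ m]mulr_natr => le2.
have := le_trans le1 le2; move: cm na0; set e0 := c / _ => e0gt0 na0.
have -> : c = e0 * (m%:R + 1) by rewrite natr1 divfK.
have := mulr_gt0 e0gt0 na0. lra.
Qed.

End Dimension.

(** * Almost Auerbach bases *)

Section Auerbach.
Context {R : realType} {X : normedModType R}.

(** Leibniz's formula; this crude bound makes a supremum of determinants finite. *)
Lemma normr_det_le {d} (W : 'M[R]_d) (B : R) :
  (forall i j, `|W i j| <= B) -> `|\det W| <= d`!%:R * B ^+ d.
Proof.
move=> WB; apply: le_trans (ler_norm_sum _ _ _) _.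
have -> : d`!%:R * B ^+ d = \sum_(s : 'S_d) B ^+ d.
  by rewrite sumr_const card_Sn mulr_natl.
apply: ler_sum => s _; rewrite normrM normr_sign mul1r normr_prod.
rewrite -[X in _ <= _ ^+ X]card_ord -prodr_const; apply: ler_prod => i _.
by rewrite normr_ge0 WB.
Qed.

(** Cramer's rule: cofactors along row [j] ignore that row, so they agree for [W] and the modified
    matrix. *)
Lemma det_replace_row {d} (W : 'M[R]_d) (a : 'rV[R]_d) j :
  W \in unitmx ->
  (a *m invmx W) ord0 j
  = (\det W)^-1 * \det (\matrix_i (if i == j then a else row i W)).
Proof.
move=> uW; rewrite /invmx uW -scalemxAr mxE; congr (_ * _).
rewrite (expand_det_row _ j) mxE; apply: eq_bigr => k _.
rewrite !mxE eqxx; congr (_ * _); rewrite /cofactor; congr (_ * \det _).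
apply/matrixP => i l; rewrite !mxE.
by rewrite eq_sym (negbTE (neq_lift _ _)) mxE.
Qed.

(* Up to a factor 2 this is Auerbach's lemma: choose vectors of the unit ball
   whose determinant is at least half the supremum. By Cramer's rule the
   coordinates of a vector of the unit ball are quotients of such determinants,
   hence bounded by 2. *)
Lemma almost_auerbach {d} {v : 'I_d -> X} : lin_indep v ->
  exists W : 'M[R]_d, [/\ W \in unitmx,
    forall i, `|comb v (row i W)| <= 1
    & forall a j, `|(a *m invmx W) ord0 j| <= 2 * `|comb v a|].
Proof.
move=> fv; have [c c0 vc] := comb_lower fv.
pose inball (W : 'M[R]_d) := forall i, `|comb v (row i W)| <= 1.
pose D := [set `|\det W| | W in inball].
have D_ub : ubound D (d`!%:R * c^-1 ^+ d).
  move=> _ [W Wb <-]; apply: normr_det_le => i j.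
  rewrite -(ler_pM2l c0) mulfV ?gt_eqF //.
  by have := vc (row i W) j; rewrite mxE => /le_trans; apply.
(* The supremum is positive, since a small multiple of the identity satisfies [inball]. *)
have [t t0 tD] : exists2 t, 0 < t & D t.
  pose S := 1 + \sum_j `|v j|.
  have S0 : 0 < S by rewrite ltr_wpDr // sumr_ge0.
  exists (S^-1 ^+ d); first by rewrite exprn_gt0 // invr_gt0.
  exists (S^-1%:M); last first.
    by rewrite det_scalar ger0_norm // exprn_ge0 // invr_ge0 ltW.
  move=> i; rewrite -scalemx1 linearZ /= row1 combZ comb_delta normrZ.
  rewrite gtr0_norm ?invr_gt0 // -(ler_pM2l S0) mulrA mulfV ?gt_eqF // mul1r mulr1.
  by rewrite /S (bigD1 i) //= addrCA lerDl addr_ge0 // sumr_ge0.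
have D_sup : has_sup D by split; [exists t|exists (d`!%:R * c^-1 ^+ d)].
have s0 : 0 < sup D by apply: lt_le_trans t0 _; exact: sup_upper_bound.
have [_ [W Wb <-] sW] : exists2 e, D e & sup D - sup D / 2 < e.
  by apply: sup_adherent => //; rewrite divr_gt0.
have dW : 0 < `|\det W| by apply: le_lt_trans sW; lra.
have uW : W \in unitmx by rewrite unitmxE unitfE -normr_gt0.
exists W; split => // a j.
have [/eqP|na0] := eqVneq `|comb v a| 0.
  by rewrite normr_eq0 => /eqP/fv ->; rewrite mul0mx mxE normr0 mulr_ge0.
have na_gt0 : 0 < `|comb v a| by rewrite lt_def na0 normr_ge0.
pose b := `|comb v a|^-1 *: a.
have -> : a = `|comb v a| *: b by rewrite scalerA mulfV // scale1r.
rewrite -scalemxAl mxE normrM normr_id combZ normrZ normr_id.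
rewrite [leRHS]mulrCA ler_wpM2l //.
have nb : `|comb v b| = 1 by rewrite combZ normrZ normfV normr_id mulVf.
rewrite nb mulr1 det_replace_row // normrM normfV mulrC ler_pdivrMr //.
apply: (@le_trans _ _ (sup D)); last by lra.
apply: sup_upper_bound => //; eexists; last reflexivity.
move=> i; rewrite rowK; case: eqP => _; [by rewrite nb|exact: Wb].
Qed.

Lemma projection_auerbach {P : {linear X -> X}} {m} {v : 'I_m -> X} :
  (forall u, P (P u) = P u) ->
  finite_dimensional (range P) -> lin_indep (P \o v) ->
  exists d, (m <= d)%N /\ exists (w : 'I_d -> X) (G : {linear X -> 'rV[R]_d}),
    [/\ forall i, `|w i| <= 1, forall i, P (w i) = w i,
        forall u, P u = comb w (G u), forall a, G (comb w a) = a
      & forall u j, `|G u ord0 j| <= 2 * `|P u|].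
Proof.
move=> PP fP fPv; have [d [md [e [fe Pe]]]] := range_basis fP fPv.
move=> /choice[k Pk]; exists d; split => //.
have [W [uW Wb WG]] := almost_auerbach fe.
(* [k u] holds the coordinates of [P u] in [e]; [invmx W] converts them to the basis given by the
   rows of [W]. *)
pose G u := k u *m invmx W.
have linG : linear G.
  move=> l x y; rewrite /G scalemxAl -mulmxDl; congr (_ *m _).
  (* The map [k] comes from a choice; uniqueness of coordinates makes it linear. *)
  by apply: (comb_inj fe); rewrite combD combZ -!Pk linearP.
pose Gl : {linear X -> 'rV[R]_d} :=
  HB.pack G (GRing.isLinear.Build R X 'rV[R]_d _ G linG).
pose w i := comb e (row i W).
have combw a : comb w a = comb e (a *m W).
  rewrite mulmx_sum_row /w {1}/comb.
  elim/big_rec2 : _ => [|i x y _ ->]; last by rewrite combD combZ.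
  by rewrite /comb big1 // => i _; rewrite mxE scale0r.
have Pcomb a : P (comb e a) = comb e a.
  rewrite /comb linear_sum; apply: eq_bigr => i _; rewrite linearZ /=.
  by have [x _ <-] := Pe i; rewrite PP.
exists w, Gl; split.
- exact: Wb.
- by move=> i; exact: Pcomb.
- by move=> u; rewrite combw /= /G mulmxKV // -Pk.
- move=> a; rewrite combw /= /G.
  have -> : k (comb e (a *m W)) = a *m W by apply: (comb_inj fe); rewrite -Pk Pcomb.
  by rewrite mulmxK.
- by move=> u j; rewrite Pk; exact: WG.
Qed.

End Auerbach.

(** * Covering numbers *)

(** If [b < a] with [b] positive, Bernoulli's inequality gives [(a / b) ^ k >= 1 + k / b], which
    exceeds [c] at [k = c * b + 1]. *)
Lemma leq_of_expn_le (a b c : nat) :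
  (forall k, a ^ k <= c * b ^ k)%N -> (a <= b)%N.
Proof.
move=> h; rewrite leqNgt; apply/negP => ab.
have [b0|b0] := posnP b.
  by have := h 1%N; rewrite b0 !expn1; lia.
have bern k : ((b + k) * b ^ k <= b * a ^ k)%N.
  elim: k => [|k IH]; first by rewrite !expn0; lia.
  by rewrite !expnS; nia.
have := bern (c * b).+1; have := h (c * b).+1.
have : (0 < b ^ (c * b).+1)%N by rewrite expn_gt0 b0.
nia.
Qed.

(** With [x] the quotient of [d] by [e.+1], split [2 ^ (x * e.+1)] into [2 ^ (x * e)], which absorbs
    [d ^ e] up to a constant, and [2 ^ x], which absorbs the constant [c]. *)
Lemma poly_lt_expn (K e : nat) :
  exists m, forall d, (m <= d)%N -> (K * d ^ e < 2 ^ d)%N.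
Proof.
pose c := (K * e.+1 ^ e)%N; exists (c * e.+1)%N => d md.
pose x := (d %/ e.+1)%N.
have cx : (c <= x)%N by rewrite leq_divRL.
have dx : (d <= e.+1 * 2 ^ x)%N.
  have := ltn_ceil d (ltn0Sn e); have := ltn_expl x (ltnSn 1); rewrite -/x; nia.
have xd : (x * e.+1 <= d)%N by exact: leq_trunc_div.
apply: (@leq_ltn_trans (c * 2 ^ (x * e))).
  rewrite /c -mulnA expnM -expnMn leq_mul2l; apply/orP; right.
  by case: (e) dx => // n dx; rewrite leq_exp2r.
apply: (@leq_trans (2 ^ (x * e.+1))); last by rewrite leq_exp2l.
rewrite mulnS expnD ltn_mul2r expn_gt0 /=.
exact: leq_ltn_trans cx (ltn_expl _ _).
Qed.

Section Covering.
Context {R : realType} {X : normedModType R} {P : {linear X -> X}}.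

(** The residual [v - c'] stays in the range of [P]; scaled up to norm at most [rho], it is covered
    by [cs] again. Each round halves the radius and multiplies the count by [size cs]. *)
Lemma covering_iter {cs : seq X} {rho : R} :
  0 < rho -> {in cs, forall c, P c = c} ->
  (forall v, P v = v -> `|v| <= rho ->
     exists2 c, c \in cs & `|v - c| <= rho / 2) ->
  forall k, exists cs' : seq X,
    [/\ (size cs' <= size cs ^ k)%N, {in cs', forall c, P c = c}
      & forall v, P v = v -> `|v| <= 1 ->
          exists2 c, c \in cs' & `|v - c| <= 2^-1 ^+ k].
Proof.
move=> rho0 Pcs cov; elim=> [|k [cs' [sz Pcs' cov']]].
  exists [:: 0]; split => // [c|v Pv v1]; first by rewrite inE => /eqP ->; rewrite linear0.
  by exists 0; rewrite ?inE // subr0 expr0.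
pose t : R := 2^-1 ^+ k / rho.
have h0 : 0 < 2^-1 ^+ k :> R by rewrite exprn_gt0.
have t0 : 0 < t by rewrite divr_gt0.
exists [seq c' + t *: c | c' <- cs', c <- cs]; split.
- by rewrite size_allpairs expnSr leq_mul2r sz orbT.
- move=> _ /allpairsP[[c' c] /= [c'in cin ->]].
  by rewrite linearD linearZ /= Pcs' ?Pcs.
move=> v Pv v1; have [c' c'in vc'] := cov' v Pv v1.
have Pd : P (t^-1 *: (v - c')) = t^-1 *: (v - c').
  by rewrite linearZ /= linearB Pv Pcs'.
have nd : `|t^-1 *: (v - c')| <= rho.
  rewrite normrZ gtr0_norm ?invr_gt0 // mulrC ler_pdivrMr //.
  by rewrite /t mulrCA mulfV ?mulr1 ?gt_eqF.
have [c cin dc] := cov _ Pd nd.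
exists (c' + t *: c); first by apply/allpairsP; exists (c', c).
have -> : v - (c' + t *: c) = t *: (t^-1 *: (v - c') - c).
  by rewrite scalerBr scalerA mulfV ?gt_eqF // scale1r opprD addrA.
rewrite normrZ gtr0_norm // exprSr.
apply: le_trans (ler_wpM2l (ltW t0) dc) _.
by rewrite /t mulrA divfK ?gt_eqF.
Qed.

Context {d : nat} {w : 'I_d -> X} {G : {linear X -> 'rV[R]_d}}.
Hypothesis w1 : forall i, `|w i| <= 1.
Hypothesis Pw : forall i, P (w i) = w i.
Hypothesis Gw : forall a, G (comb w a) = a.
Hypothesis Gbound : forall u j, `|G u ord0 j| <= 2 * `|P u|.

Lemma comb_fixed a : P (comb w a) = comb w a.
Proof.
by rewrite /comb linear_sum; apply: eq_bigr => i _; rewrite linearZ /= Pw.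
Qed.

(** Grid points with coordinates in [{0, ..., L} / (d * L + 1)] lie in the unit ball. Two of them
    within [r] of one centre are at most [2 * r] apart, so their coordinates differ by at most
    [4 * r], less than the mesh. *)
Lemma grid_covering {cs : seq X} {r : R} {L : nat} :
  (forall v, P v = v -> `|v| <= 1 -> exists2 c, c \in cs & `|v - c| <= r) ->
  4 * r * (d * L + 1)%:R < 1 -> (L.+1 ^ d <= size cs)%N.
Proof.
move=> cov rL.
pose D : R := (d * L + 1)%:R.
have D0 : 0 < D by rewrite /D ltr0n addn1.
pose a (g : {ffun 'I_d -> 'I_L.+1}) : 'rV[R]_d := \row_j ((g j)%:R / D).
have ua1 g : `|comb w (a g)| <= 1.
  apply: le_trans (ler_norm_sum _ _ _) _.
  apply: (@le_trans _ _ (\sum_(j < d) L%:R / D)).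
    apply: ler_sum => j _; rewrite normrZ mxE ger0_norm ?divr_ge0 ?ler0n ?(ltW D0) //.
    apply: (@le_trans _ _ ((g j)%:R / D * 1)).
      by rewrite ler_wpM2l ?divr_ge0 ?ler0n ?(ltW D0).
    by rewrite mulr1 ler_pM2r ?invr_gt0 // ler_nat -ltnS.
  rewrite sumr_const card_ord -[_ *+ d]mulr_natl mulrA ler_pdivrMr // mul1r -natrM ler_nat.
  lia.
have cell g : exists i : 'I_(size cs), `|comb w (a g) - cs`_i| <= r.
  have [c cin gc] := cov _ (comb_fixed (a g)) (ua1 g).
  have ci : (index c cs < size cs)%N by rewrite index_mem.
  by exists (Ordinal ci); rewrite /= nth_index.
have [h hP] := choice cell.
suff inj_h : injective h by have := leq_card h inj_h; rewrite card_ffun !card_ord.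
move=> g g' hh; apply/ffunP => j; apply/val_inj/eqP => /=.
have near_gg' : `|comb w (a g - a g')| <= 2 * r.
  rewrite combB -(subrK (cs`_(h g)) (comb w (a g))) -addrA.
  apply: le_trans (ler_normD _ _) _; rewrite mulr_natl mulr2n lerD //.
  by rewrite distrC hh.
have := Gbound (comb w (a g - a g')) j; rewrite comb_fixed Gw !mxE -mulrBl.
rewrite normrM (gtr0_norm (_ : 0 < D^-1)) ?invr_gt0 // ler_pdivrMr // => le1.
have lt1 : `|(g j)%:R - (g' j)%:R : R| < 1.
  apply: le_lt_trans le1 _; apply: le_lt_trans rL.
  by rewrite -/D ler_pM2r //; move: near_gg'; lra.
rewrite eqn_leq; apply/andP; split; rewrite -ltnS -(ltr_nat R) -natr1;
  move: lt1; rewrite ltr_norml => /andP[]; lra.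
Qed.

(* Iterating the covering [k] times covers the unit ball of the range of [P] by
   [size cs ^ k] balls of radius [2^-k], while that ball contains about
   [(2^k / d)^d] points of a grid which lie in different such balls; let
   [k] tend to infinity. *)
Lemma covering_size {cs : seq X} {rho : R} :
  0 < rho -> {in cs, forall c, P c = c} ->
  (forall v, P v = v -> `|v| <= rho ->
     exists2 c, c \in cs & `|v - c| <= rho / 2) ->
  (2 ^ d <= size cs)%N.
Proof.
(* Rounding in [L] costs the factor [d.+1 ^ d]; four extra halvings, costing [size cs ^ 4], give the
   strict inequality needed in [grid_covering]. *)
move=> rho0 Pcs cov; apply: (@leq_of_expn_le _ _ (d.+1 ^ d * size cs ^ 4)) => k.
have [cs' [sz _ cov']] := covering_iter rho0 Pcs cov (k + 4).
pose L := (2 ^ k %/ d.+1)%N.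
have dL : (d * L <= 2 ^ k)%N.
  by apply: leq_trans (leq_trunc_div (2 ^ k) d.+1); rewrite mulnC leq_mul2l leqnSn orbT.
have k0 : (0 < 2 ^ k)%N by rewrite expn_gt0.
have rL : 4 * (2^-1 ^+ (k + 4)) * (d * L + 1)%:R < 1 :> R.
  rewrite exprVn -mulrA mulrCA mulrC ltr_pdivrMr ?exprn_gt0 // mul1r.
  rewrite -natrX -natrM ltr_nat expnD; lia.
have := leq_trans (grid_covering cov' rL) sz.
rewrite -expnM mulnC expnM expnD => h.
apply: (@leq_trans ((d.+1 * L.+1) ^ d)).
  have [->//|dpos] := posnP d.
  by rewrite leq_exp2r // mulnC ltnW // ltn_ceil.
by rewrite expnMn -mulnA leq_mul2l [(_ ^ 4 * _)%N]mulnC h orbT.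
Qed.

End Covering.

(** * Consequences of the estimates *)

(** A duplicate-free list in [Q] of maximal length exhausts [Q]. *)
Lemma finite_of_size_le {T : eqType} (Q : T -> Prop) (N : nat) :
  (forall s : seq T, uniq s -> {in s, forall i, Q i} -> (size s <= N)%N) ->
  exists s : seq T, (size s <= N)%N /\ forall i, Q i -> i \in s.
Proof.
move=> h.
pose E n := `[< exists2 s : seq T, uniq s /\ {in s, forall i, Q i} & size s = n >].
have exE : exists n, E n by exists 0%N; apply/asboolP; exists [::].
have Ele n : E n -> (n <= N)%N by move=> /asboolP[s [us Qs] <-]; exact: h.
case: (ex_maxnP exE Ele) => n /asboolP[s [us Qs] <-] smax.
exists s; split=> [|i Qi]; first exact: h.
apply/negPn/negP => si.
suff /smax : E (size s).+1 by rewrite ltnn.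
apply/asboolP; exists (i :: s) => //; split; first by rewrite /= si.
by move=> j; rewrite inE => /predU1P[->//|/Qs].
Qed.

Section Estimates.
Context {R : realType}.

(** Testing the estimate on the signs of [phi] over [s], with [n = size s], gives
    [n * t <= A * n ^ (1/q)], so [n ^ (1 - 1/q) <= A / t <= B]. As [q > 1], the power [q / (q - 1)]
    of this bounds [n]. *)
Lemma upper_count {phi : nat -> R} {A q t : R} {B e : nat} {s : seq nat} :
  1 < q -> 0 < t ->
  (forall a : {fsfun nat -> R with 0},
     `|\sum_(i <- finsupp a) a i * phi i|
       <= A * (\sum_(i <- finsupp a) `|a i| `^ q) `^ q^-1) ->
  A / t <= B%:R -> (0 < B)%N -> q / (q - 1) <= e%:R ->
  uniq s -> {in s, forall i, t <= `|phi i|} -> (size s <= B ^ e)%N.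
Proof.
move=> q1 t0 h AB B0 qe us ts.
have [->//|n0] := posnP (size s).
have q0 : 0 < q by lra.
have phi0 i : i \in s -> phi i != 0.
  by move=> /ts; apply: contraTneq => ->; rewrite normr0 -ltNge.
pose a : {fsfun nat -> R with 0} := [fsfun i in [fset i in s]%fset => Num.sg (phi i)].
have aE i : i \in s -> a i = Num.sg (phi i) by move=> si; rewrite fsfunE inE si.
have supp_a : perm_eq (finsupp a) s.
  apply: uniq_perm => // i; rewrite mem_finsupp fsfunE inE.
  by case: ifP => [si|]; rewrite ?eqxx // sgr_eq0 phi0.
have := h a; rewrite !(perm_big _ supp_a) /=.
set x : R := (size s)%:R; have x0 : 0 < x by rewrite ltr0n.
have sum_const c : \sum_(i <- s) c = x * c.
  by rewrite big_const_seq count_predT iter_addr_0 mulr_natl.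
have -> : \sum_(i <- s) `|a i| `^ q = x.
  rewrite -[RHS]mulr1 -sum_const; apply: eq_big_seq => i si.
  by rewrite aE // normr_sg phi0 // powR1.
move=> le1.
have {le1} le2 : x * t <= A * x `^ q^-1.
  apply: le_trans le1; apply: le_trans (ler_norm _).
  rewrite -sum_const big_seq [leRHS]big_seq.
  by apply: ler_sum => i si; rewrite aE // -normrEsg ts.
have xq : x = x `^ q^-1 * x `^ (1 - q^-1).
  by rewrite -powRD ?subrKC ?powRr1 ?ltW // gt_eqF ?implybT.
have le3 : x `^ (1 - q^-1) <= B%:R.
  apply: le_trans AB; rewrite ler_pdivlMr //.
  rewrite -(ler_pM2l (powR_gt0 q^-1 x0)) mulrA -xq mulrC.
  by rewrite mulrC [leRHS]mulrC.
rewrite -(ler_nat R) -/x natrX -powR_mulrn //.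
have -> : x = (x `^ (1 - q^-1)) `^ (q / (q - 1)).
  rewrite -powRrM [X in _ `^ X](_ : _ = 1) ?powRr1 ?ltW //.
  by field; lra.
apply: (@le_trans _ _ (B%:R `^ (q / (q - 1)))).
  by apply: ge0_ler_powR => //; rewrite ?nnegrE ?powR_ge0 // divr_ge0; lra.
by apply: ler_powR => //; rewrite ler1n.
Qed.

(** Integrality enters here: [|k i| <= |k i| ^ p] for integers, so the lower estimate for the
    coefficients [delta * k i] bounds the number of terms with multiplicity. *)
Lemma lower_sum_le {Z : normedModType R} {z : nat -> Z} {p C delta M : R}
    {N : nat} {k : {fsfun nat -> int with 0}} :
  1 <= p -> 0 < C -> 0 < delta -> lower_estimate z p C ->
  `|\sum_(i <- finsupp k) (delta * (k i)%:~R) *: z i| <= M ->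
  (C * M / delta) `^ p <= N%:R ->
  (\sum_(i <- finsupp k) `|k i|%N <= N)%N.
Proof.
move=> p1 C0 delta0 lo kM MN.
have p0 : 0 < p by lra.
pose a : {fsfun nat -> R with 0} := [fsfun i in finsupp k => delta * (k i)%:~R].
have supp_a : finsupp a = finsupp k.
  apply/fsetP => i; rewrite [LHS]mem_finsupp fsfunE.
  case: ifP => [ik|_]; last by rewrite eqxx.
  by rewrite mulf_neq0 ?intr_eq0 -?mem_finsupp ?lt0r_neq0.
have aE i : i \in finsupp k -> a i = delta * (k i)%:~R by rewrite fsfunE => ->.
have := lo a; rewrite supp_a.
under [X in _ <= `|X| -> _]eq_big_seq => i ik do rewrite aE //.
move=> /le_trans/(_ kM); rewrite ler_pdivrMl // => le1.
set s := \sum_(i <- finsupp k) `|a i| `^ p in le1.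
have s0 : 0 <= s by apply: sumr_ge0 => i _; exact: powR_ge0.
have CM0 : 0 <= C * M by apply: le_trans le1; exact: powR_ge0.
have le2 : s <= (C * M) `^ p.
  have -> : s = (s `^ p^-1) `^ p by rewrite -powRrM mulVf ?powRr1 // gt_eqF.
  by apply: ge0_ler_powR le1; rewrite ?nnegrE ?powR_ge0 ?(ltW p0).
rewrite -(ler_nat R) (le_trans _ MN) // natr_sum.
have {le2} : \sum_(i <- finsupp k) delta `^ p * `|k i|%N%:R <= (C * M) `^ p.
  apply: le_trans le2; rewrite /s big_seq [leRHS]big_seq.
  apply: ler_sum => i ik.
  have k1 : 1 <= `|k i|%N%:R :> R by rewrite ler1n absz_gt0 -mem_finsupp.
  rewrite aE // normrM (gtr0_norm delta0) powRM ?(ltW delta0) //.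
  by rewrite ler_wpM2l ?powR_ge0 // -intr_norm -abszE le1r_powR.
rewrite -mulr_sumr -{1}[C * M](divfK (lt0r_neq0 delta0)) mulrC.
rewrite [(_ * delta) `^ p]powRM ?(ltW delta0) ?divr_ge0 ?(ltW delta0) //.
by rewrite ler_pM2r ?powR_gt0.
Qed.
End Estimates.

(** * Signed sums and operators *)

Section SignedSums.
Context {X : zmodType}.

(** Sums of at most [n] elements of [T] up to sign, with repetitions; the letter [0] admits the
    shorter sums. *)
Definition signed_sums (T : seq X) (n : nat) : seq X :=
  iter n (fun L => [seq a + b | a <- 0 :: T ++ map -%R T, b <- L]) [:: 0].

Lemma size_signed_sums T n :
  size (signed_sums T n) = ((size T).*2.+1 ^ n)%N.
Proof.
elim: n => [//|n IH].
by rewrite /= size_cat size_map size_allpairs IH size_cat size_map addnn expnS mulSn.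
Qed.

Lemma signed_sumsS T n a b :
  a \in 0 :: T ++ map -%R T -> b \in signed_sums T n ->
  a + b \in signed_sums T n.+1.
Proof.
by move=> aT bn; rewrite /signed_sums iterS; apply/allpairsP; exists (a, b).
Qed.

Lemma signed_sums_le T m n b :
  (m <= n)%N -> b \in signed_sums T m -> b \in signed_sums T n.
Proof.
move=> /subnK <- bm; elim: (n - m)%N => [//|i IH]; rewrite addSn -[b]add0r.
by apply: signed_sumsS => //; exact: mem_head.
Qed.

Lemma signed_sumsMz T n a b (k : int) :
  a \in T -> b \in signed_sums T n -> a *~ k + b \in signed_sums T (`|k| + n).
Proof.
move=> aT bn.
have step c : c \in T ++ map -%R T -> forall j : nat,
    c *+ j + b \in signed_sums T (j + n).
  move=> cT; elim=> [|j IH]; first by rewrite mulr0n add0r.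
  by rewrite mulrS -addrA addSn; apply: signed_sumsS => //; rewrite inE cT orbT.
case: k => j; first by apply: step; rewrite mem_cat aT.
rewrite NegzE mulrNz -mulNrz abszN; apply: step.
by rewrite mem_cat map_f ?orbT.
Qed.

Lemma sum_signed_sums {I : eqType} (l : seq I) (y : I -> X) (k : I -> int) T :
  {in l, forall i, y i \in T} ->
  \sum_(i <- l) y i *~ k i \in signed_sums T (\sum_(i <- l) `|k i|%N).
Proof.
elim: l => [|i l IH] yT; first by rewrite !big_nil inE.
rewrite !big_cons; apply: signed_sumsMz; first by apply: yT; exact: mem_head.
by apply: IH => j jl; apply: yT; rewrite inE jl orbT.
Qed.

(** Keeps the centres of the covering in the range of [P], as [covering_iter] requires. *)
Lemma signed_sums_fixed {P : {additive X -> X}} {T n} :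
  {in T, forall c, P c = c} -> {in signed_sums T n, forall c, P c = c}.
Proof.
move=> PT; elim: n => [c|n IH c]; first by rewrite inE => /eqP ->; rewrite raddf0.
rewrite /signed_sums iterS => /allpairsP[[a b] /= [aT bn ->]].
rewrite raddfD (IH b bn); congr (_ + _).
move: aT; rewrite inE mem_cat => /orP[/eqP ->|/orP[/PT //|]]; first exact: raddf0.
by move=> /mapP[c' /PT e ->]; rewrite raddfN e.
Qed.

End SignedSums.

Section Operators.
Context {R : realType} {X Z : normedModType R}.

Lemma pi_property_bound {P : nat -> {linear X -> X}} :
  (ereal_sup (range (fun n => opnorm (P n))) < +oo)%E ->
  exists2 La : R, 0 < La & forall n u, `|P n u| <= La * `|u|.
Proof.
set M := ereal_sup _ => Moo.
have PM n u : `|u| <= 1 -> (`|P n u|%:E <= M)%E.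
  move=> u1; apply: (@le_trans _ _ (opnorm (P n))).
    by apply: ereal_sup_ubound; exists u.
  by apply: ereal_sup_ubound; exists n.
have M0 : (0 <= M)%E by have := PM 0%N 0; rewrite linear0 normr0; apply.
have Mfin : M \is a fin_num by rewrite ge0_fin_numE.
(* Adding 1 makes the bound positive even if [M] is 0. *)
exists (fine M + 1); first by rewrite ltr_wpDl // fine_ge0.
move=> n u; have [->|u0] := eqVneq u 0; first by rewrite linear0 !normr0 mulr0.
have nu : 0 < `|u| by rewrite normr_gt0.
have : `|P n (`|u|^-1 *: u)| <= fine M.
  rewrite -lee_fin fineK //; apply: PM.
  by rewrite normrZ normfV normr_id mulVf ?gt_eqF.
rewrite linearZ /= normrZ normfV normr_id ler_pdivrMl // mulrC => /le_trans; apply.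
by rewrite ler_wpM2r // lerDl.
Qed.

(** [z i] is its own one-term expansion, so the matching series in [X] tends both to [S (z i)] and
    to [x i]. *)
Lemma associated_op {x : nat -> X} {f : nat -> {linear X -> R^o}} {z : nat -> Z} :
  associated x f z ->
  exists S : {linear Z -> X}, (forall i, S (z i) = x i) /\
    exists2 K : R, 0 < K & forall u, `|S u| <= K * `|u|.
Proof.
move=> [[S [Scont Sx]] _]; exists S; split; last first.
  have /linear_bounded_continuous/linear_boundedP/pinfty_ex_gt0[K K0 SK] := Scont.
  by exists K.
move=> i; pose a j : R := (j == i)%:R.
have series_a (V : normedModType R) (y : nat -> V) :
    series (fun j => a j *: y j) @ \oo --> y i.
  apply: cvg_near_cst; exists i.+1 => // n /= ni.
  rewrite /series /= big_mkord (bigD1 (Ordinal ni)) //= /a eqxx scale1r.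
  rewrite big1 ?addr0 // => j ji; rewrite (_ : (_ == _) = false) ?scale0r //.
  by apply/negbTE; apply: contra_neq ji => e; exact/val_inj.
by have := cvg_unique _ (Sx a _ (series_a Z z)) (series_a X x); apply.
Qed.

End Operators.

(** * Proof of the theorem *)

Section Main.
Context {R : realType} {X Z : normedModType R}.

(* Testing the upper [l_q] estimate on signs [a_i = sg (G (x i) j)] shows that
   few [x i] can have a large [j]-th coordinate. *)
Lemma large_coords {z : nat -> Z} {x : nat -> X} {S : {linear Z -> X}} {d}
    {G : {linear X -> 'rV[R]_d}} {q C K H t : R} {B e : nat} :
  1 < q -> 0 < t -> 0 <= K -> 0 <= H -> upper_estimate z q C ->
  (forall i, S (z i) = x i) -> (forall u, `|S u| <= K * `|u|) ->
  (forall u j, `|G u ord0 j| <= H * `|u|) ->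
  H * K * C / t <= B%:R -> (0 < B)%N -> q / (q - 1) <= e%:R ->
  exists s : seq nat, (size s <= d * B ^ e)%N /\
    forall i j, t <= `|G (x i) ord0 j| -> i \in s.
Proof.
move=> q1 t0 K0 H0 up Sz SK GH HB B0 qe.
have /choice[s sP] j : exists s : seq nat, (size s <= B ^ e)%N /\
    forall i, t <= `|G (x i) ord0 j| -> i \in s.
  apply: finite_of_size_le => s us Qs.
  (* A functional of norm at most [H * K] sends [z i] to [phi i]. *)
  apply: (upper_count (phi := fun i => G (x i) ord0 j) q1 t0 _ HB B0 qe us Qs) => a.
  have -> : \sum_(i <- finsupp a) a i * G (x i) ord0 j
      = G (S (\sum_(i <- finsupp a) a i *: z i)) ord0 j.
    rewrite !linear_sum summxE; apply: eq_bigr => i _.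
    by rewrite !linearZ /= Sz mxE.
  apply: le_trans (GH _ _) _; rewrite -!mulrA ler_wpM2l //.
  by apply: le_trans (SK _) _; rewrite ler_wpM2l.
exists (flatten [seq s j | j <- enum 'I_d]); split.
  rewrite size_flatten /shape -map_comp sumnE big_map big_enum /=.
  rewrite -[X in (_ <= X * _)%N]card_ord -sum_nat_const.
  by apply: leq_sum => j _; have [] := sP j.
move=> i j tij; apply/flatten_mapP; exists j; first by rewrite mem_enum.
by have [_] := sP j; apply.
Qed.

Lemma norm_comb_le {d} {w : 'I_d -> X} {a : 'rV[R]_d} {t : R} :
  (forall i, `|w i| <= 1) -> (forall j, `|a ord0 j| <= t) ->
  `|comb w a| <= d%:R * t.
Proof.
move=> w1 at_; apply: le_trans (ler_norm_sum _ _ _) _.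
have -> : d%:R * t = \sum_(j < d) t * 1.
  by rewrite sumr_const card_ord mulr1 mulr_natl.
by apply: ler_sum => j _; rewrite normrZ ler_pM.
Qed.

(* A vector of norm at most [rho] is within [eps] of some
   [\sum_i delta k_i x_i], and the lower estimate bounds [\sum_i |k_i|] by [N].
   Apply [P] and drop the terms with [|P (x i)| <= eta]. *)
Lemma NQP_covering {P : {linear X -> X}} {x : nat -> X} {z : nat -> Z}
    {p C eps delta C' La rho eta : R} {N : nat} {s : seq nat} :
  1 <= p -> 0 < C -> lower_estimate z p C ->
  0 < eps -> 0 < delta -> 1 <= C' -> 0 <= eta ->
  (forall v : X, exists k : {fsfun nat -> int with 0},
      `|\sum_(i <- finsupp k) (delta * (k i)%:~R) *: z i| <= C' * `|v| /\
      `|v - \sum_(i <- finsupp k) (delta * (k i)%:~R) *: x i| <= eps) ->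
  (forall u, `|P u| <= La * `|u|) -> 0 < La ->
  (C * (C' * rho) / delta) `^ p <= N%:R ->
  (forall i, i \notin s -> `|P (x i)| <= eta) ->
  forall v, P v = v -> `|v| <= rho ->
    exists2 c, c \in [seq delta *: c | c <- signed_sums [seq P (x i) | i <- s] N]
      & `|v - c| <= La * eps + delta * eta * N%:R.
Proof.
move=> p1 C0 lo eps0 delta0 C'1 eta0 nqp PLa La0 hN small v Pv vr.
have [k [kz kx]] := nqp v.
have kN : (\sum_(i <- finsupp k) `|k i|%N <= N)%N.
  apply: (lower_sum_le p1 C0 delta0 lo _ hN); apply: le_trans kz _.
  by rewrite ler_wpM2l // (le_trans ler01).
set u := \sum_(i <- finsupp k) _ in kx.
pose l := [seq i <- finsupp k | i \in s].
exists (delta *: \sum_(i <- l) P (x i) *~ k i).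
  apply: map_f; apply: (@signed_sums_le _ _ (\sum_(i <- l) `|k i|%N)).
    apply: leq_trans kN; rewrite big_filter.
    by rewrite [leqRHS](bigID (mem s)) /= leq_addr.
  by apply: sum_signed_sums => i; rewrite mem_filter => /andP[si _]; exact: map_f.
(* As [P v = v], the error is [P (v - u)] plus the image under [P] of the discarded terms. *)
have -> : v - delta *: (\sum_(i <- l) P (x i) *~ k i)
    = P (v - u) + \sum_(i <- finsupp k | i \notin s) (delta * (k i)%:~R) *: P (x i).
  have -> : P (v - u) = v - \sum_(i <- finsupp k) (delta * (k i)%:~R) *: P (x i).
    by rewrite linearB Pv linear_sum; under eq_bigr do rewrite linearZ.
  rewrite [\sum_(i <- finsupp k) _](bigID (mem s)) /= opprD addrA subrK; congr (_ - _).
  rewrite big_filter scaler_sumr; apply: eq_bigr => i _.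
  by rewrite -scaler_int scalerA.
apply: le_trans (ler_normD _ _) _; apply: lerD.
  by apply: le_trans (PLa _) _; rewrite ler_wpM2l // ltW.
apply: le_trans (ler_norm_sum _ _ _) _.
apply: (@le_trans _ _ (delta * eta * (\sum_(i <- finsupp k | i \notin s) `|k i|%N)%:R)).
  rewrite natr_sum mulr_sumr; apply: ler_sum => i si.
  rewrite normrZ normrM (gtr0_norm delta0) -intr_norm -abszE [leRHS]mulrAC.
  by rewrite ler_wpM2l ?small // mulr_ge0 ?(ltW delta0).
rewrite ler_wpM2l ?mulr_ge0 ?(ltW delta0) // ler_nat (leq_trans _ kN) //.
by rewrite [leqRHS](bigID (mem s)) /= leq_addl.
Qed.

End Main.

Theorem corollary4p5 (R : realType) (X Z : completeNormedModType R)
  (z : nat -> Z) (p q C : R)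
  (hXinf : ~ finite_dimensional [set: X])
  (hXpi : pi_property X)
  (hz : schauder_basis z)
  (hq : 1 < q) (hqp : q < p) (hC : 0 < C)
  (hlower : lower_estimate z p C)
  (hupper : upper_estimate z q C)
  (x : nat -> X) (f : nat -> {linear X -> R^o})
  (hxf : schauder_frame x f) :
  ~ NQP x f z.
Proof.
move=> [assoc [eps [delta [C' [eps0 delta0 C'1 nqp]]]]].
have [P [Pfr Pbd Plim]] := hXpi.
have [La La0 PLa] := pi_property_bound Pbd.
have [S [Sz [K K0 SK]]] := associated_op assoc.
have ltbound (y : R) : y <= (Num.bound `|y|)%:R.
  by apply: le_trans (ler_norm y) (ltW _); exact: archi_boundP.
(* Chosen so that [La * eps + eps = rho / 2]. *)
pose rho := 2 * (La + 1) * eps.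
pose N := (Num.bound `|(C * (C' * rho) / delta) `^ p|).+1.
pose e := Num.bound `|q / (q - 1)|.
(* The discarded terms, at most [N] with multiplicity and each at most [delta * eta], contribute at
   most [eps]. *)
pose eta := eps / (delta * N%:R).
pose B := (Num.bound `|2 * La * K * C / eta|).+1.
have rho0 : 0 < rho by rewrite !mulr_gt0 // ltr_wpDl // ltW.
have eta0 : 0 < eta by rewrite divr_gt0 // mulr_gt0.
(* There will be [(2 * size s + 1) ^ N] centres with [size s <= d * (2 * B * d) ^ e]; this is the
   resulting polynomial in [d]. *)
have [m hm] := poly_lt_expn ((3 * (2 * B) ^ e) ^ N) (e.+1 * N).
(* Taking [m.+1] vectors ensures [0 < d]. *)
have [v fv] := exists_lin_indep hXinf m.+1.
have [n fPv] := lin_indep_approx Plim fv.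
have [_ PP fP] := Pfr n.
have [d [md [w [G [w1 Pw PG Gw Gb]]]]] := projection_auerbach PP fP fPv.
have d0 : (0 < d)%N by exact: leq_trans md.
have d0R : 0 < d%:R :> R by rewrite ltr0n.
have GLa u j : `|G u ord0 j| <= (2 * La) * `|u|.
  by apply: le_trans (Gb u j) _; rewrite -mulrA ler_wpM2l.
(* The threshold is [eta / d] per coordinate, since [d] coordinates add up; the bound thus grows
   linearly in [d]. *)
have HB : 2 * La * K * C / (eta / d%:R) <= (2 * B * d)%:R.
  rewrite invf_div mulrA -mulrA [d%:R / eta]mulrC mulrA natrM ler_pM2r //.
  apply: le_trans (ltbound _) _; rewrite ler_nat.
  by apply: (@leq_trans B); [exact: leqnSn|exact: leq_pmull].
have Bd0 : (0 < 2 * B * d)%N by rewrite !muln_gt0.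
have [s [sz sP]] := large_coords hq (divr_gt0 eta0 d0R) (ltW K0)
  (mulr_ge0 (ler0n _ 2) (ltW La0)) hupper Sz SK GLa HB Bd0 (ltbound _).
have small i : i \notin s -> `|P n (x i)| <= eta.
  move=> si; rewrite PG -[leRHS](divfK (lt0r_neq0 d0R)) mulrC.
  apply: norm_comb_le => // j; rewrite leNgt; apply: contraNN si => /ltW.
  exact: sP.
have hN : (C * (C' * rho) / delta) `^ p <= N%:R.
  by apply: le_trans (ltbound _) _; rewrite ler_nat.
have p1 : 1 <= p by exact: ltW (lt_trans hq hqp).
have cov := NQP_covering p1 hC hlower eps0 delta0 C'1 (ltW eta0) nqp (PLa n) La0 hN small.
set cs := map _ _ in cov.
have Pcs : {in cs, forall c, P n c = c}.
  move=> _ /mapP[c cin ->]; rewrite linearZ; congr (_ *: _).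
  by apply: signed_sums_fixed cin => _ /mapP[i _ ->]; exact: PP.
have radius : La * eps + delta * eta * N%:R = rho / 2.
  have N0 : N%:R != 0 :> R by rewrite pnatr_eq0.
  rewrite /eta /rho; field.
  by rewrite N0 lt0r_neq0.
rewrite radius in cov.
have := covering_size w1 Pw Gw Gb rho0 Pcs cov.
rewrite size_map size_signed_sums size_map leqNgt => /negP; apply.
apply: leq_ltn_trans (hm d (ltnW md)).
rewrite expnM -expnMn leq_exp2r //.
(* Positivity lets the factor 3 absorb the [+ 1] in [2 * size s + 1]. *)
have t0 : (0 < d * (2 * B * d) ^ e)%N by rewrite muln_gt0 d0 expn_gt0 Bd0.
apply: (@leq_trans (3 * (d * (2 * B * d) ^ e))).
  by move: sz t0; move: (d * _)%N => y; clear; lia.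
by rewrite expnMn expnS mulnCA !mulnA [(_ * d)%N]mulnC !mulnA.
Qed.
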